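(* Given integers $n, a, b \geq 1$ and nonzero matrices $A \in \mathbb{C}^{n \times a}$, $B \in \mathbb{C}^{n \times b}$, we have the (rank $\leq 1$) lower bound $$A A^* \circ B B^* \ \geq \ \frac{1}{\min(\operatorname{rk}(A A^* ), \operatorname{rk}(B B^* ))} \cdot d_{A_0 B_0^T}\, d_{A_0 B_0^T}^*,$$ where $A_0$ appends $p + \max(a,b) - a$ zero columns to the right of $A$, and $B_0$ appends $p + \max(a,b) - b$ zero columns to the right of $B$, for some integer $p \geq 0$. Moreover, the choice of constant is best possible.
   Context: For complex matrices $X=(x_{jk})$, $Y=(y_{jk})$ of the same size, the Schur (entrywise) product $X \circ Y$ has $(j,k)$ entry $x_{jk} y_{jk}$. For $n \times n$ complex matrices $X, Y$, $X \geq Y$ (Loewner ordering) means that $X - Y$ is positive semidefinite, i.e. Hermitian with non-negative eigenvalues. For a square matrix $M = (m_{jk}) \in \mathbb{C}^{n\times n}$, $d_M := (m_{11}, \dots, m_{nn})^T$ denotes the column vector of its diagonal entries. $X^T$ is the transpose (no conjugation) and $X^*$ the conjugate transpose; $\operatorname{rk}$ denotes rank. *)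

(* Defs.v *)
From HB Require Import structures.
From mathcomp Require Import all_boot all_order all_algebra.
From mathcomp Require Import reals complex.

Set Implicit Arguments.
Unset Strict Implicit.
Unset Printing Implicit Defensive.

Import Order.TTheory GRing.Theory Num.Theory.

Local Open Scope ring_scope.
Local Open Scope sesquilinear_scope.

Definition schurmx {K : pzSemiRingType} {m n : nat} (X Y : 'M[K]_(m, n)) :
  'M[K]_(m, n) := map2_mx *%R X Y.

(* In a numClosedFieldType, [0 <= z] forces z to be real. *)
Definition psdmx {C : numClosedFieldType} {n : nat} (M : 'M[C]_n) : Prop :=
  M \is hermsymmx /\ (forall z : C, eigenvalue M z -> 0 <= z).

Definition loewner_ge {C : numClosedFieldType} {n : nat} (X Y : 'M[C]_n) :
  Prop := psdmx (X - Y).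

Definition diagcol {K : Type} {n : nat} (M : 'M[K]_n) : 'cV[K]_n :=
  \col_i M i i.

Definition gram {C : numClosedFieldType} {n a : nat} (A : 'M[C]_(n, a)) :
  'M[C]_n := A *m A ^t*.

Definition zero_pad {K : nmodType} {n a m : nat} (le_am : (a <= m)%N)
    (A : 'M[K]_(n, a)) : 'M[K]_(n, m) :=
  castmx (erefl n, subnKC le_am) (row_mx A (0 : 'M[K]_(n, m - a))).

Lemma leq_padl (p a b : nat) : (a <= p + maxn a b)%N.
Proof. exact: leq_trans (leq_maxl a b) (leq_addl p _). Qed.

Lemma leq_padr (p a b : nat) : (b <= p + maxn a b)%N.
Proof. exact: leq_trans (leq_maxr a b) (leq_addl p _). Qed.

(* The vector d_{A_0 B_0^T}, where A_0 and B_0 are A and B padded to the common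
   width p + max(a, b). *)
Definition diag_pad {K : pzSemiRingType} {n a b : nat} (p : nat)
    (A : 'M[K]_(n, a)) (B : 'M[K]_(n, b)) : 'cV[K]_n :=
  diagcol (zero_pad (leq_padl p a b) A *m (zero_pad (leq_padr p a b) B)^T).

Definition diag_pad_outer {C : numClosedFieldType} {n a b : nat} (p : nat)
    (A : 'M[C]_(n, a)) (B : 'M[C]_(n, b)) : 'M[C]_n :=
  diag_pad p A B *m (diag_pad p A B) ^t*.

(* Main.v *)
(* For a row vector [v], put [M = A^T diag(v) B].  The quadratic form of
   [AA^* o BB^*] at [v] is the squared Frobenius norm of [M], while that of
   [d d^*] is [|tr M|^2] once [A] and [B] are padded to a common width.  The bound
   is therefore [|tr M|^2 <= rk(M) |M|_F^2], with [rk M <= min(rk A, rk B)].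
   Partial identities of ranks [r] and [s] show that the constant is optimal:
   there [d^T] is an eigenvector with eigenvalue [1 - c min(r, s)]. *)
Require Import Defs.
From HB Require Import structures.
From mathcomp Require Import all_boot all_order all_algebra.
From mathcomp Require Import reals complex ring.

Set Implicit Arguments.
Unset Strict Implicit.
Unset Printing Implicit Defensive.

Import Order.TTheory GRing.Theory Num.Theory.

Local Open Scope ring_scope.

Section ConjugateTranspose.

Local Open Scope sesquilinear_scope.

Variable C : numClosedFieldType.

Lemma trmxC_mul m n p (X : 'M[C]_(m, n)) (Y : 'M[C]_(n, p)) :
  (X *m Y) ^t* = Y ^t* *m X ^t*.
Proof. by rewrite trmx_mul map_mxM. Qed.

Lemma trmxCB m n (X Y : 'M[C]_(m, n)) : (X - Y) ^t* = X ^t* - Y ^t*.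
Proof. by apply/matrixP => i j; rewrite !mxE rmorphB. Qed.

Lemma trmxCZ m n (k : C) (X : 'M[C]_(m, n)) : (k *: X) ^t* = k^* *: X ^t*.
Proof. by apply/matrixP => i j; rewrite !mxE rmorphM. Qed.

Lemma mxtrace_trmxC n (X : 'M[C]_n) : \tr (X ^t*) = (\tr X)^*.
Proof. by rewrite -map_trmx mxtrace_tr trace_map_mx. Qed.

Lemma gram_trmxC n a (A : 'M[C]_(n, a)) : (gram A) ^t* = gram A.
Proof. by rewrite /gram trmxC_mul trmxCK. Qed.

Lemma mxtrace_gram n a (A : 'M[C]_(n, a)) :
  \tr (gram A) = \sum_i \sum_j `|A i j| ^+ 2.
Proof.
apply: eq_bigr => i _; rewrite mxE; apply: eq_bigr => j _.
by rewrite !mxE normCK.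
Qed.

Lemma mxtrace_gram_ge0 n a (A : 'M[C]_(n, a)) : 0 <= \tr (gram A).
Proof.
by rewrite mxtrace_gram; do 2!(apply: sumr_ge0 => ? _); rewrite exprn_ge0.
Qed.

Lemma mxtrace_gram_eq0 n a (A : 'M[C]_(n, a)) : (\tr (gram A) == 0) = (A == 0).
Proof.
apply/eqP/eqP => [|->]; last by rewrite /gram mul0mx mxtrace0.
have sqr_ge0 i j : 0 <= `|A i j| ^+ 2 by rewrite exprn_ge0.
rewrite mxtrace_gram => /psumr_eq0P A0; apply/matrixP => i j; rewrite mxE.
have /psumr_eq0P Ai0 := A0 (fun i _ => sumr_ge0 _ (fun j _ => sqr_ge0 i j)) i isT.
have /eqP := Ai0 (fun j _ => sqr_ge0 i j) j isT.
by rewrite expf_eq0 normr_eq0 => /eqP.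
Qed.

(** If [x A A^* = 0] then [x A A^* x^*], the squared norm of [x A], vanishes, so [A] and [A A^*]
    have the same left kernel. The proof takes all of [kermx (gram A)] as [x] at once. *)
Lemma mxrank_gram n a (A : 'M[C]_(n, a)) : \rank (gram A) = \rank A.
Proof.
apply/eqP; rewrite eqn_leq mxrankM_maxl /=.
have kerA : (kermx (gram A) <= kermx A)%MS.
  apply/sub_kermxP/eqP; rewrite -mxtrace_gram_eq0 /gram trmxC_mul.
  by rewrite -mulmxA (mulmxA A) mulmxA mulmx_ker mul0mx mxtrace0.
move/mxrankS: kerA; rewrite !mxrank_ker leq_sub2lE //; exact: rank_leq_row.
Qed.

Lemma orthogonal_projector m n (X : 'M[C]_(m, n)) :
  exists P : 'M[C]_n, [/\ P ^t* = P, P *m P = P, X *m P = X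
    & \tr P = (\rank X)%:R].
Proof.
have := mulmx_base X; have := row_base_free X.
move: (row_base X) (col_base X) => V Y freeV XE; pose G := gram V.
have uG : G \in unitmx by rewrite -row_free_unit /row_free mxrank_gram.
exists (V ^t* *m invmx G *m V); split.
- by rewrite !trmxC_mul trmxCK trmx_inv map_invmx gram_trmxC mulmxA.
- by rewrite !mulmxA -(mulmxA _ V) mulmxKV.
- by rewrite -{1}XE !mulmxA -(mulmxA _ V) mulmxK.
- by rewrite mxtrace_mulC mulmxA mulmxV // mxtrace1.
Qed.

(* Expand [0 <= |X - k P|^2] in the Frobenius norm, for [P] the orthogonal
   projector onto the row space of [X] and [k = \tr X / \rank X]. *)
Lemma mxtrace_sqr_le_rank n (X : 'M[C]_n) :
  `|\tr X| ^+ 2 <= (\rank X)%:R * \tr (gram X).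
Proof.
have [->|X0] := eqVneq X 0; first by rewrite mxtrace0 normr0 expr0n mxrank0 mul0r.
have [P [Ph Pi XP trP]] := orthogonal_projector X.
have r_gt0 : 0 < (\rank X)%:R :> C by rewrite ltr0n lt0n mxrank_eq0.
set r : C := (\rank X)%:R in trP r_gt0 *.
pose t := \tr X; pose k := t / r.
have PX : \tr (P *m X ^t*) = t^*.
  by rewrite -{1}Ph -trmxC_mul XP mxtrace_trmxC.
have kc : k^* = t^* / r by rewrite /k /r rmorphM fmorphV rmorph_nat.
have := mxtrace_gram_ge0 (X - k *: P).
have -> : gram (X - k *: P) =
    gram X - k^* *: (X *m P) - k *: (P *m X ^t*) + (k * k^*) *: P.
  rewrite /gram trmxCB trmxCZ Ph mulmxBl !mulmxBr.
  by rewrite -!scalemxAl -!scalemxAr Pi scalerA opprB addrA addrAC.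
rewrite !linearD !linearN !linearZ /= XP PX trP -/t.
rewrite kc /k -/t normCK.
have -> : \tr (gram X) - t^* / r * t - t / r * t^* + t / r * (t^* / r) * r
  = \tr (gram X) - t * t^* / r.
  by field; rewrite gt_eqF.
by rewrite subr_ge0 ler_pdivrMr // [X in _ <= X]mulrC.
Qed.

(** On an eigenvector [v] for [z] the form equals [z |v|^2] with [|v|^2 > 0]. The trace only turns a
    1 x 1 matrix into a scalar. *)
Lemma psdmx_quadratic_form n (M : 'M[C]_n) : M ^t* = M ->
  (forall v : 'rV_n, 0 <= \tr (v *m M *m v ^t*)) -> psdmx M.
Proof.
move=> Mh Mpos; split; first by apply/is_hermitianmxP; rewrite scale1r Mh.
move=> z /eigenvalueP [v vM v0]; have := Mpos v.
have vv_gt0 : 0 < \tr (gram v).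
  by rewrite lt_def mxtrace_gram_eq0 v0 mxtrace_gram_ge0.
by rewrite vM -scalemxAl mxtraceZ pmulr_lge0.
Qed.

(** Both sides are the double sum of [u_k X_kl Y_kl w_l]. *)
Lemma schurmx_form n (X Y : 'M[C]_n) (u w : 'rV[C]_n) :
  \tr (u *m schurmx X Y *m w^T) = \tr (diag_mx u *m Y *m diag_mx w *m X^T).
Proof.
rewrite trace_mx11 mxE /mxtrace.
under eq_bigr => l _ do rewrite !mxE mulr_suml.
rewrite exchange_big /=; apply: eq_bigr => k _.
rewrite mxE; apply: eq_bigr => l _.
by rewrite mul_diag_mx mul_mx_diag !mxE; ring.
Qed.

Lemma schurmx_gram_form n a b (A : 'M[C]_(n, a)) (B : 'M[C]_(n, b))
    (v : 'rV[C]_n) :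
  \tr (v *m schurmx (gram A) (gram B) *m v ^t*) =
  \tr (gram (A^T *m diag_mx v *m B)).
Proof.
have -> : v ^t* = (map_mx Num.conj v)^T by rewrite map_trmx.
rewrite schurmx_form /gram !trmxC_mul trmx_mul tr_diag_mx map_diag_mx.
have -> : A^T ^t* = (A ^t*)^T by rewrite map_trmx.
by rewrite !mulmxA mxtrace_mulC !mulmxA.
Qed.

Lemma mulmx_diagcol n a (A B : 'M[C]_(n, a)) (v : 'rV[C]_n) :
  (v *m diagcol (A *m B^T)) 0 0 = \tr (A^T *m diag_mx v *m B).
Proof.
rewrite -mulmxA mxtrace_mulC mul_diag_mx mxE /mxtrace.
apply: eq_bigr => k _; rewrite !mxE big_distrr /=; apply: eq_bigr => j _.
by rewrite !mxE; ring.
Qed.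

Lemma schurmx_trmxC n (X Y : 'M[C]_n) :
  (schurmx X Y) ^t* = schurmx (X ^t*) (Y ^t*).
Proof. by apply/matrixP => i j; rewrite !mxE rmorphM. Qed.

Lemma schurmx_gram_ge n m (A B : 'M[C]_(n, m)) (k : C) :
    0 <= k -> k * (minn (\rank (gram A)) (\rank (gram B)))%:R <= 1 ->
  loewner_ge (schurmx (gram A) (gram B))
    (k *: gram (diagcol (A *m B^T))).
Proof.
move=> k_ge0 k_le; apply: psdmx_quadratic_form => [|v].
  rewrite trmxCB trmxCZ schurmx_trmxC !gram_trmxC.
  by rewrite (conj_Creal (ger0_real k_ge0)).
set M := A^T *m diag_mx v *m B.
rewrite mulmxBr mulmxBl linearB /= schurmx_gram_form -scalemxAr -scalemxAl.
set d := diagcol _; have -> : v *m gram d *m v ^t* = gram (v *m d).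
  by rewrite /gram trmxC_mul !mulmxA.
have trd : \tr (gram (v *m d)) = `|\tr M| ^+ 2.
  by rewrite mxtrace_gram !big_ord1 mulmx_diagcol.
rewrite linearZ /= trd subr_ge0.
have rkM : (\rank M <= minn (\rank (gram A)) (\rank (gram B)))%N.
  rewrite !mxrank_gram leq_min mxrankM_maxr andbT /M -mulmxA.
  by rewrite (leq_trans (mxrankM_maxl _ _)) ?mxrank_tr.
apply: le_trans (ler_wpM2l k_ge0 (mxtrace_sqr_le_rank M)) _.
rewrite mulrA ler_piMl ?mxtrace_gram_ge0 //.
by apply: le_trans k_le; rewrite ler_wpM2l // ler_nat.
Qed.

Lemma gram_zero_pad n a m (le_am : (a <= m)%N) (A : 'M[C]_(n, a)) :
  gram (zero_pad le_am A) = gram A.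
Proof.
(* Generalizing [m - a] to [k] allows [m] to be replaced by [a + k], which makes the cast
   trivial. *)
rewrite /gram /zero_pad; move: (m - a)%N (subnKC le_am) => k e.
move: le_am; case: m / e => _; rewrite castmx_id.
by rewrite tr_row_mx map_col_mx mul_row_col mul0mx addr0.
Qed.

Lemma zero_pad_pid n a m r (le_am : (a <= m)%N) : (r <= a)%N ->
  zero_pad le_am (pid_mx r : 'M[C]_(n, a)) = pid_mx r.
Proof.
move=> le_ra; rewrite /zero_pad; move: (m - a)%N (subnKC le_am) => k e.
move: le_am; case: m / e => _; rewrite castmx_id.
apply/matrixP => i j; rewrite !mxE; case: splitP => l jl; rewrite !mxE ?jl //.
(* A one in padding column [a + l] would need [a + l < r], against [r <= a]. *)
have [/= ->|//] := eqVneq.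
by rewrite ltnNge (leq_trans le_ra) ?leq_addr // andbF.
Qed.

Lemma gram_pid n a r : (r <= a)%N ->
  gram (pid_mx r : 'M[C]_(n, a)) = pid_mx r.
Proof. by move=> le_ra; rewrite /gram tr_pid_mx map_pid_mx pid_mx_id. Qed.

Lemma schurmx_pid n r s :
  schurmx (pid_mx r) (pid_mx s) = pid_mx (minn r s) :> 'M[C]_n.
Proof.
apply/matrixP => i j; rewrite !mxE -natrM mulnb leq_min.
by case: (_ == _ :> nat).
Qed.

Lemma pid_outer_ge n t (k : C) : (0 < t <= n)%N ->
  loewner_ge (pid_mx t) (k *: gram (diagcol (pid_mx t : 'M[C]_n))) ->
  k * t%:R <= 1.
Proof.
move=> /andP[t_gt0 le_tn] [_ pos]; set d := diagcol _ in pos.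
have dE i : d i 0 = (i < t)%:R by rewrite !mxE eqxx.
have dpid : d^T *m pid_mx t = d^T.
  apply/rowP => j; rewrite mxE (bigD1 j) //= big1 => [|i].
    by rewrite !mxE !eqxx /= -natrM mulnb andbb addr0.
  by rewrite -val_eqE => /negPf ij; rewrite !mxE ij mulr0.
(* [d] is the indicator vector of the first [t] indices, so its squared norm counts them. *)
have dd : d^T *m d = (t%:R)%:M.
  apply/matrixP => i j; rewrite !ord1 !mxE eqxx.
  under eq_bigr => l _ do rewrite mxE !dE -natrM mulnb andbb.
  rewrite -natr_sum -[in RHS](card_ord t) -sum1_card.
  rewrite (big_ord_widen n (fun=> 1%N) le_tn) [in RHS]big_mkcond /=.
  by congr (_%:R); apply: eq_bigr => l _; case: ltnP.
have dC : d ^t* = d^T.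
  by apply/rowP => i; rewrite !mxE eqxx conjC_nat.
rewrite -subr_ge0; apply: pos; apply/eigenvalueP; exists d^T.
  rewrite mulmxBr -scalemxAr dpid /gram dC mulmxA dd mul_scalar_mx.
  by rewrite scalerA scalerBl scale1r.
(* The eigenvector is nonzero because its entry at index 0 is 1, as [t > 0]. *)
apply/eqP => /rowP/(_ (Ordinal (leq_trans t_gt0 le_tn))).
by rewrite mxE dE mxE /= t_gt0; apply/eqP/oner_neq0.
Qed.

End ConjugateTranspose.

Local Open Scope complex_scope.

Theorem corollary1p16 (R : realType) (n a b p : nat)
    (hn : (1 <= n)%N) (ha : (1 <= a)%N) (hb : (1 <= b)%N) :
  (forall (A : 'M[R[i]]_(n, a)) (B : 'M[R[i]]_(n, b)),
     A != 0 -> B != 0 ->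
     let c : R := 1 / (minn (\rank (gram A)) (\rank (gram B)))%:R in
     loewner_ge (schurmx (gram A) (gram B)) (c%:C *: diag_pad_outer p A B)
     /\ (\rank (c%:C *: diag_pad_outer p A B)%R <= 1)%N)
  /\
  (* For all dimensions and all possible ranks r, s of AA^*, BB^*, no larger
     constant works uniformly in A and B. *)
  (forall r s : nat,
     (1 <= r <= minn n a)%N -> (1 <= s <= minn n b)%N ->
     forall c : R,
       (forall (A : 'M[R[i]]_(n, a)) (B : 'M[R[i]]_(n, b)),
          \rank (gram A) = r -> \rank (gram B) = s ->
          loewner_ge (schurmx (gram A) (gram B))
                     (c%:C *: diag_pad_outer p A B)) ->
       c <= 1 / (minn r s)%:R).
Proof.
split=> [A B A0 B0 c | r s /andP[r_gt0] + /andP[s_gt0] + c ge_c].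
  split; last first.
    rewrite (leq_trans (mxrank_scale _ _)) //.
    by rewrite (leq_trans (mxrankM_maxr _ _)) ?rank_leq_row.
  have min_gt0 : (0 < minn (\rank (gram A)) (\rank (gram B)))%N.
    by rewrite leq_min !mxrank_gram !lt0n !mxrank_eq0 A0.
  (* Padding leaves the Gram matrices unchanged and gives both factors the common width needed to
     form [M] as a square matrix. *)
  rewrite -(gram_zero_pad (leq_padl p a b) A).
  rewrite -(gram_zero_pad (leq_padr p a b) B).
  apply: schurmx_gram_ge; first by rewrite ler0c divr_ge0.
  rewrite !gram_zero_pad -(rmorph_nat (real_complex R)) -rmorphM /= lecR.
  by rewrite /c divfK // pnatr_eq0 -lt0n.
rewrite !leq_min => /andP[le_rn le_ra] /andP[le_sn le_sb].
have := ge_c (pid_mx r) (pid_mx s).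
rewrite !gram_pid // !rank_pid_mx // => /(_ erefl erefl).
rewrite schurmx_pid /diag_pad_outer /diag_pad !zero_pad_pid //.
(* The product of the padded partial identities has rank capped by the common width as well; this
   cap is never attained below [minn r s]. *)
have le_rs : (minn r s <= p + maxn a b)%N.
  by rewrite geq_min (leq_trans le_ra) ?leq_padl.
rewrite tr_pid_mx mul_pid_mx (minn_idPr le_rs).
move=> /pid_outer_ge; rewrite leq_min r_gt0 s_gt0 geq_min le_rn => /(_ isT).
rewrite -(rmorph_nat (real_complex R)) -rmorphM /= lecR.
by rewrite -ler_pdivlMr // ltr0n leq_min r_gt0.
Qed.
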